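(* Let $n\in\mathbb{N}$, $\mu\in\mathbb{R}^n$, $\Sigma$ a positive definite $n\times n$ matrix, $X\sim\mathcal{N}_n(\mu,\Sigma)$, $a\in\mathbb{R}^n\setminus\{0\}$ (a row vector) and $Y=aX$. Let $B=\{Y\in B_1\}$, where $B_1\subseteq\mathbb{R}$ is a Borel set with $\mathbb{P}[Y\in B_1]>0$. Then $$\mathrm{Var}_{B}[X]=\mathrm{Var}[X]+\left(\mathrm{Var}_{B}[Y]-\mathrm{Var}[Y]\right)\beta\beta^{T},$$ where $\beta=(\beta_1,\dots,\beta_n)^T$ and $\beta_i=\frac{\mathrm{Cov}[Y,X_i]}{\mathrm{Var}[Y]}$.
   Context: $\mathcal{N}_n(\mu,\Sigma)$ denotes the $n$-dimensional normal distribution with mean $\mu$ and covariance matrix $\Sigma$; $X=(X_1,\dots,X_n)^T$ is a column vector and $Y=aX=\sum_{i=1}^n a_iX_i$. For an event $B$ with $\mathbb{P}[B]>0$ and a random vector $Z$, $\mathrm{Var}_B[Z]=\mathbb{E}[(Z-\mathbb{E}[Z\mid B])(Z-\mathbb{E}[Z\mid B])^T\mid B]$ is the conditional covariance matrix of $Z$ given $B$. *)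

(* Defs.v *)
From HB Require Import structures.
From mathcomp Require Import all_boot all_order all_algebra.
From mathcomp Require Import all_classical all_reals all_analysis.

Set Implicit Arguments.
Unset Strict Implicit.
Unset Printing Implicit Defensive.

Import Order.TTheory GRing.Theory Num.Theory.
Import numFieldNormedType.Exports.

Local Open Scope classical_set_scope.
Local Open Scope ring_scope.

(* The carrier of R^n is [n.-tuple R], whose library sigma-algebra (generated by
   the coordinate maps) is the Borel one. *)

Section lebesgue_tuple.
Context {R : realType}.
Local Open Scope ereal_scope.

(* [lebesgue_measure], declared on [measurableTypeR R], restated over R itself so
   that products with measures on tuples can be formed. *)
Definition lebesgueR : set R -> \bar R := lebesgue_measure.

Let lebesgueR0 : lebesgueR set0 = 0.
Proof. exact: (measure0 (@lebesgue_measure R)). Qed.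

Let lebesgueR_ge0 A : 0 <= lebesgueR A.
Proof. exact: (measure_ge0 (@lebesgue_measure R)). Qed.

Let lebesgueR_sigma_additive : semi_sigma_additive lebesgueR.
Proof. exact: (@measure_semi_sigma_additive _ _ _ (@lebesgue_measure R)). Qed.

HB.instance Definition _ := isMeasure.Build _ _ _ lebesgueR
  lebesgueR0 lebesgueR_ge0 lebesgueR_sigma_additive.

Let lebesgueR_sigma_finite : sigma_finite setT lebesgueR.
Proof. exact: (@sigma_finiteT _ _ _ (@lebesgue_measure R)). Qed.

HB.instance Definition _ := Measure_isSigmaFinite.Build _ _ _
  lebesgueR lebesgueR_sigma_finite.

Definition cons_pair n (p : R * n.-tuple R) : n.+1.-tuple R :=
  [tuple of p.1 :: p.2].

Lemma measurable_cons_pair n : measurable_fun [set: R * n.-tuple R] (@cons_pair n).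
Proof. exact: measurable_cons. Qed.

Section step.
Context n (m : {sigma_finite_measure set (n.-tuple R) -> \bar R}).

(* The product of the Lebesgue measure on R with m, transported along the
   isomorphism between R x R^n and R^n.+1. *)
Definition lebesgue_tupleS : set (n.+1.-tuple R) -> \bar R :=
  pushforward (lebesgueR \x m) (@cons_pair n).

Let lebesgue_tupleS0 : lebesgue_tupleS set0 = 0.
Proof. by rewrite /lebesgue_tupleS /pushforward preimage_set0 measure0. Qed.

Let lebesgue_tupleS_ge0 A : 0 <= lebesgue_tupleS A.
Proof. exact: (measure_ge0 (lebesgueR \x m)). Qed.

Let lebesgue_tupleS_sigma_additive : semi_sigma_additive lebesgue_tupleS.
Proof.
have mf A : measurable A -> measurable (@cons_pair n @^-1` A).
  by move=> mA; rewrite -[X in measurable X]setTI; exact: measurable_cons_pair.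
move=> F mF tF mUF; rewrite /lebesgue_tupleS /pushforward preimage_bigcup.
apply: measure_semi_sigma_additive => [k||]; first exact: mf.
- apply/trivIsetP => /= i j _ _ ij; rewrite -preimage_setI.
  by move/trivIsetP : tF => /(_ _ _ _ _ ij) ->//; rewrite preimage_set0.
- by rewrite -preimage_bigcup; exact: mf.
Qed.

HB.instance Definition _ := isMeasure.Build _ _ _ lebesgue_tupleS
  lebesgue_tupleS0 lebesgue_tupleS_ge0 lebesgue_tupleS_sigma_additive.

Let split_pair (t : n.+1.-tuple R) : R * n.-tuple R := (thead t, [tuple of behead t]).

Let measurable_split_pair : measurable_fun setT split_pair.
Proof.
apply/measurable_fun_pairP; split; last exact: measurable_behead.
exact: (@measurable_tnth _ R n.+1 ord0).
Qed.

Let cons_pairK : cancel (@cons_pair n) split_pair.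
Proof. by case=> x t; congr pair; apply/val_inj. Qed.

Let lebesgue_tupleS_sigma_finite : sigma_finite setT lebesgue_tupleS.
Proof.
have [F FT Foo] : sigma_finite setT (lebesgueR \x m).
  have /sigma_finiteP[F [TF ndF Foo]] := sigma_finiteT lebesgueR.
  have /sigma_finiteP[G [TG ndG Goo]] := sigma_finiteT m.
  exists (fun k => F k `*` G k).
    rewrite -setXTT TF TG; apply/seteqP; split => [[x y] /=|[x y] [k _ []]].
      move=> [[k _ Fkx] [l _ Gly]]; exists (maxn k l) => //; split.
        by move: x Fkx; exact/subsetPset/ndF/leq_maxl.
      by move: y Gly; exact/subsetPset/ndG/leq_maxr.
    by split; exists k.
  move=> k; have [? ?] := Foo k; have [? ?] := Goo k.
  split; first exact: measurableX.
  by rewrite product_measure1E// lte_mul_pinfty// ge0_fin_numE.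
exists (fun k => split_pair @^-1` F k); first by rewrite -preimage_bigcup -FT.
move=> k; have [mF Fk] := Foo k; split.
  by rewrite -[X in measurable X]setTI; exact: measurable_split_pair.
rewrite /lebesgue_tupleS /pushforward.
rewrite -comp_preimage (_ : _ \o _ = id) ?preimage_id//.
by apply/funext => p; exact: cons_pairK.
Qed.

HB.instance Definition _ := Measure_isSigmaFinite.Build _ _ _
  lebesgue_tupleS lebesgue_tupleS_sigma_finite.

End step.

Fixpoint lebesgue_tuple n : {sigma_finite_measure set (n.-tuple R) -> \bar R} :=
  match n with
  | 0 => \d_([tuple] : 0.-tuple R)
  | n'.+1 => lebesgue_tupleS (lebesgue_tuple n')
  end.

Lemma lebesgue_tuple_box n (A : 'I_n -> set R) : (forall i, measurable (A i)) ->
  lebesgue_tuple n [set t | forall i, A i (tnth t i)] =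
  \prod_(i < n) lebesgueR (A i).
Proof.
elim: n A => [|n IH] A mA.
  by rewrite big_ord0 /= diracE mem_set// => -[].
rewrite big_ord_recl -IH// /= /lebesgue_tupleS /pushforward.
rewrite -product_measure1E//.
  congr (_ _); apply/seteqP; split => [[x t] /= h|[x t] /= [h0 h] i].
    split; first exact: (h ord0).
    by move=> i; have := h (lift ord0 i); rewrite tnthS.
  by have [j ->|->//] := unliftP ord0 i; rewrite tnthS.
rewrite (_ : [set _ | _] = \bigcap_(i in [set: 'I_n]) (@tnth n R ^~ i @^-1` A (lift ord0 i))); last first.
  by apply/seteqP; split=> t h i; [move=> _; exact: h|exact: (h i I)].
apply: fin_bigcap_measurable => // i _.
by rewrite -[X in measurable X]setTI; exact: measurable_tnth.
Qed.

End lebesgue_tuple.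

Section multivariate_normal.
Context {R : realType}.

(* Positive definite matrices are taken to be symmetric. *)
Definition posdefmx n (S : 'M[R]_n) : Prop :=
  S^T = S /\ forall v : 'cV[R]_n, v != 0 -> 0 < (v^T *m S *m v) 0 0.

Definition colvec n (t : n.-tuple R) : 'cV[R]_n := \col_i tnth t i.

Definition mvnormal_pdf n (mu : 'cV[R]_n) (S : 'M[R]_n) (x : 'cV[R]_n) : R :=
  (Num.sqrt ((2 * pi) ^+ n * \det S))^-1 *
  expR (- (((x - mu)^T *m invmx S *m (x - mu)) 0 0 / 2)).

Definition mvnormal n (mu : 'cV[R]_n) (S : 'M[R]_n) (A : set (n.-tuple R)) : \bar R :=
  (\int[lebesgue_tuple n]_(x in A) (mvnormal_pdf mu S (colvec x))%:E)%E.

End multivariate_normal.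

Section conditioning.
Context d (T : measurableType d) (R : realType) (P : probability T R).

(* E[Z | B] = E[Z 1_B] / P(B); [fine] sends infinite integrals to 0, so this is
   meaningful when Z is integrable on B and P(B) > 0. *)
Definition cond_exp (B : set T) (Z : T -> R) : R :=
  fine (\int[P]_(w in B) (Z w)%:E)%E / fine (P B).

Definition cond_var (B : set T) (Z : T -> R) : R :=
  cond_exp B (fun w => (Z w - cond_exp B Z) ^+ 2).

Definition cond_expmx (B : set T) m n (Z : T -> 'M[R]_(m, n)) : 'M[R]_(m, n) :=
  \matrix_(i, j) cond_exp B (fun w => Z w i j).

Definition cond_varmx (B : set T) n (Z : T -> 'cV[R]_n) : 'M[R]_n :=
  cond_expmx B (fun w => (Z w - cond_expmx B Z) *m (Z w - cond_expmx B Z)^T).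

Definition covmx n (Z : T -> 'cV[R]_n) : 'M[R]_n :=
  \matrix_(i, j) fine (covariance P (fun w => Z w i 0) (fun w => Z w j 0)).

End conditioning.

(* Main.v *)
(* Translating Lebesgue measure by [Sigma c^T] multiplies the normal density by
   a constant times exp(c X), so E[f(X) exp(c X)] is a constant times
   E[f(X + Sigma c^T)].  When a Sigma c^T = 0 this shift does not change Y = a X,
   hence E[h(Y) exp(c X)] = E[h(Y)] E[exp(c X)].  Differentiating at 0 in one or
   two such directions c shows that the first and second moments of the linear
   forms c X factor against every h(Y).  With c_i = e_i - beta_i a this applies to
   Z_i = X_i - beta_i Y, so conditioning on Y \in B_1 leaves the covariances of
   the Z_i unchanged, makes them uncorrelated with Y, and only alters the variance
   of Y in X_i = Z_i + beta_i Y. *)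
Require Import Defs.
From HB Require Import structures.
From mathcomp Require Import all_boot all_order all_algebra.
From mathcomp Require Import all_classical all_reals all_analysis.
From mathcomp Require Import measurable_realfun ring lra.

Set Implicit Arguments.
Unset Strict Implicit.
Unset Printing Implicit Defensive.

Import Order.TTheory GRing.Theory Num.Theory.
Import numFieldNormedType.Exports.

Local Open Scope classical_set_scope.
Local Open Scope ring_scope.

(** * Translation invariance of Lebesgue measure on R^n *)

Section translation.
Context {R : realType}.
Local Open Scope ereal_scope.

Lemma measurable_addl (c : R) : measurable_fun [set: R] (+%R c).
Proof. exact: measurable_funD. Qed.

(** Lebesgue measure is determined by its values on the intervals []a, b]], and translation
    preserves their lengths. *)
Lemma lebesgueR_translation (c : R) (A : set R) : measurable A ->
  pushforward lebesgueR (+%R c) A = lebesgueR A.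
Proof.
move=> mA; apply/esym.
(* The uniqueness lemma needs a measure on [measurableTypeR R]; packing the translation as a
   measurable function there gives its pushforward that structure. *)
pose f := (+%R c : measurableTypeR R -> measurableTypeR R).
have mf : measurable_fun setT f by exact: measurable_addl.
pose Mf := isMeasurableFun.Build _ _ _ _ _ mf.
pose F : {mfun measurableTypeR R >-> measurableTypeR R} := HB.pack f Mf.
apply: (@lebesgue_measure_unique R (pushforward (@lebesgue_measure R) F)) => //.
move=> _ [[a b] _ <-] /=.
rewrite /pushforward (_ : F @^-1` _ = `](a - c)%R, (b - c)%R]%classic); last first.
  by apply/seteqP; split=> x /=; rewrite !in_itv/= /f ltrBlDl lerBrDl.
rewrite !lebesgue_measure_itv/= !lte_fin ltrD2r.
by case: ifP => // _; rewrite -!EFinD; congr (_%:E); ring.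
Qed.

Lemma ge0_integral_translationR (c : R) (f : R -> \bar R) :
  measurable_fun [set: R] f -> (forall x, 0 <= f x) ->
  \int[lebesgueR]_x f (c + x)%R = \int[lebesgueR]_x f x.
Proof.
move=> mf f0; rewrite -(@ge0_integral_pushforward _ _ _ _ _ _ (measurable_addl c) lebesgueR setT f)//.
apply: eq_measure_integral => [|mf' A mA _]; first exact: measurable_addl.
exact: lebesgueR_translation.
Qed.

Definition addt n (v x : n.-tuple R) : n.-tuple R :=
  [tuple (tnth v i + tnth x i)%R | i < n].

Lemma addt_cons n (v : n.+1.-tuple R) (p : R * n.-tuple R) :
  addt v (cons_pair p) =
  cons_pair ((thead v + p.1)%R, addt [tuple of behead v] p.2).
Proof.
apply: eq_from_tnth => i; rewrite tnth_mktuple.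
have [j ->|->] := unliftP ord0 i; last by rewrite /thead.
rewrite !tnthS tnth_mktuple tnth_behead; congr (tnth v _ + _)%R.
(* [tnth_behead] indexes by [inord j.+1], which has the same value as [lift ord0 j]. *)
by apply: val_inj; rewrite /= inordK// ltnS ltn_ord.
Qed.

Lemma measurable_addt n (v : n.-tuple R) : measurable_fun setT (@addt n v).
Proof.
apply/measurable_fun_tnthP => i.
rewrite (_ : _ \o _ = (fun x => tnth v i + tnth x i)%R).
  by apply: measurable_funD => //; exact: measurable_tnth.
by apply/funext => x /=; rewrite tnth_mktuple.
Qed.

Lemma ge0_integral_lebesgue_tupleS n (f : n.+1.-tuple R -> \bar R) :
  measurable_fun setT f -> (forall x, 0 <= f x) ->
  \int[lebesgue_tuple n.+1]_x f x =
  \int[lebesgueR]_x \int[lebesgue_tuple n]_t f (cons_pair (x, t)).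
Proof.
move=> mf f0.
rewrite [LHS](@ge0_integral_pushforward _ _ _ _ _ _ (@measurable_cons_pair R n) (lebesgueR \x lebesgue_tuple n) setT f)//.
rewrite preimage_setT fubini_tonelli1//; last by move=> x; exact: f0.
exact: (measurableT_comp mf (@measurable_cons_pair R n)).
Qed.

(** Induction on [n]: Tonelli splits off the first coordinate, the induction hypothesis removes the
    shift from the inner integral, and the one-dimensional case removes it from the outer one. *)
Lemma ge0_integral_translation n (v : n.-tuple R) (f : n.-tuple R -> \bar R) :
  measurable_fun setT f -> (forall x, 0 <= f x) ->
  \int[lebesgue_tuple n]_x f (addt v x) = \int[lebesgue_tuple n]_x f x.
Proof.
elim: n v f => [v f _ _|n IH v f mf f0].
  by apply: eq_integral => x _; rewrite (tuple0 x) tuple0.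
have mfc : measurable_fun setT (f \o @cons_pair R n).
  exact: (measurableT_comp mf (@measurable_cons_pair R n)).
rewrite !ge0_integral_lebesgue_tupleS//; last first.
  exact: (measurableT_comp mf (measurable_addt v)).
under eq_integral => x _.
  under eq_integral => t _ do rewrite addt_cons/=.
  rewrite (IH _ (fun t => f (cons_pair ((thead v + x)%R, t))))//; last first.
    exact: (measurableT_comp mfc (pair1_measurable _)).
  over.
apply: (@ge0_integral_translationR (thead v) (fun y => \int[lebesgue_tuple n]_t f (cons_pair (y, t)))).
  by apply: (measurable_fun_fubini_tonelli_F (m2 := lebesgue_tuple n) (f \o @cons_pair R n)) => // x; exact: f0.
by move=> x; exact: integral_ge0.
Qed.

End translation.

(** * Integration against a measure given by a density *)

Section density.
Context d (T : measurableType d) (R : realType).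
Context (nu : {finite_measure set T -> \bar R}).
Context (m : {sigma_finite_measure set T -> \bar R}) (g : T -> \bar R).
Local Open Scope ereal_scope.

(** The Radon-Nikodym derivative of [nu] satisfies this change of variables, and it agrees with [g]
    almost everywhere because both have the same integral over every measurable set. *)
Lemma ge0_integral_density (f : T -> \bar R) :
  measurable_fun setT g -> (forall x, 0 <= g x) ->
  (forall A, measurable A -> nu A = \int[m]_(x in A) g x) ->
  measurable_fun setT f -> (forall x, 0 <= f x) ->
  \int[nu]_x f x = \int[m]_x (f x * g x).
Proof.
move=> mg g0 nuE mf f0.
have num : nu `<< m.
  apply/null_content_dominatesP => A mA mA0.
  by rewrite nuE// null_set_integral//; exact: measurable_funTS.
rewrite -(Radon_Nikodym_SigmaFinite.change_of_variables num)//.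
apply: ae_eq_integral => //.
- apply: emeasurable_funM => //.
  exact: measurable_int (Radon_Nikodym_SigmaFinite.f_integrable num).
- exact: emeasurable_funM.
apply: ae_eqe_mul2l; apply: integral_ae_eq => //.
  exact: Radon_Nikodym_SigmaFinite.f_integrable.
by move=> E _ mE; rewrite -nuE// -Radon_Nikodym_SigmaFinite.f_integral.
Qed.

End density.

(** * The normal density under a shift of its argument *)

Section gaussian_shift.
Context {R : realType} (n : nat).
Implicit Types (M S : 'M[R]_n) (c : 'rV[R]_n) (mu x : 'cV[R]_n).

Lemma colvec_addt (v x : n.-tuple R) : colvec (addt v x) = colvec v + colvec x.
Proof. by apply/colP => i; rewrite !mxE tnth_mktuple. Qed.

Lemma posdefmx_unitmx S : posdefmx S -> S \in unitmx.
Proof.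
move=> [_ S0]; rewrite unitmxE unitfE; apply/det0P => -[v v0 vS].
have vt0 : v^T != 0 by rewrite -(inj_eq (@trmx_inj _ _ _)) trmxK trmx0.
by have := S0 _ vt0; rewrite trmxK vS mul0mx mxE ltxx.
Qed.

Lemma mvnormal_pdf_ge0 mu S x : 0 <= mvnormal_pdf mu S x.
Proof. by rewrite mulr_ge0 ?invr_ge0 ?sqrtr_ge0 ?expR_ge0. Qed.

(** In the quadratic form of [y - S *m c^T], with y = x - mu, the inverse of [S] cancels: both cross
    terms become [c *m y] and the last term [c *m S *m c^T]. *)
Lemma mvnormal_pdf_shift mu S c x : posdefmx S ->
  mvnormal_pdf mu S (x - S *m c^T) =
  mvnormal_pdf mu S x * expR ((c *m (x - mu)) 0 0 - (c *m S *m c^T) 0 0 / 2).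
Proof.
move=> Sp; have Su := posdefmx_unitmx Sp; have [St _] := Sp.
rewrite /mvnormal_pdf -mulrA -expRD; congr (_ * expR _).
set y := x - mu; rewrite (_ : x - _ - mu = y - S *m c^T); last first.
  by rewrite addrAC.
clearbody y.
have tr11 (A : 'M[R]_1) : A^T = A.
  by apply/matrixP => i j; rewrite !ord1 mxE.
have Stc : (S *m c^T)^T = c *m S by rewrite trmx_mul trmxK St.
rewrite [(_ - _)^T]linearB/= Stc mulmxBl !mulmxBr !mulmxBl.
rewrite -(mulmxA c S (invmx S)) mulmxV// mulmx1.
(* The second cross term is the transpose of the first, and a 1 x 1 matrix is its own transpose. *)
rewrite (_ : y^T *m invmx S *m (S *m c^T) = c *m y); last first.
  by rewrite mulmxA mulmxKV// -[RHS]tr11 trmx_mul.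
rewrite !mulmxA !mxE; lra.
Qed.

Lemma measurable_mulmx_colvec c :
  measurable_fun setT (fun x : n.-tuple R => (c *m colvec x) 0 0).
Proof.
under eq_fun do rewrite mxE.
apply: measurable_sum => i.
under eq_fun do rewrite mxE.
by apply: measurable_funM => //; exact: measurable_tnth.
Qed.

Lemma measurable_mvnormal_pdf mu S :
  measurable_fun setT (fun x : n.-tuple R => mvnormal_pdf mu S (colvec x)).
Proof.
apply: measurable_funM => //; apply: measurableT_comp => //.
apply: measurableT_comp => //; apply: measurable_funM => //.
have mcoord i : measurable_fun setT (fun x : n.-tuple R => (colvec x - mu) i 0).
  under eq_fun do rewrite !mxE.
  by apply: measurable_funB => //; exact: measurable_tnth.
rewrite (_ : (fun t : n.-tuple R => _) = (fun t : n.-tuple R =>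
    \sum_j (\sum_i (colvec t - mu) i 0 * invmx S i j) * (colvec t - mu) j 0)).
  apply: measurable_sum => j; apply: measurable_funM => //.
  by apply: measurable_sum => i; exact: measurable_funM.
apply/funext => x; rewrite mxE; apply: eq_bigr => j _; rewrite mxE.
by congr (_ * _); apply: eq_bigr => i _; rewrite [_^T _ _]mxE.
Qed.

End gaussian_shift.

(** * Differentiation of exponential integrals under the integral sign *)

Section moment.
Context {R : realType}.

Lemma expR_ge_norm (u : R) : `|u| <= expR u + expR (- u).
Proof.
have := expR_ge1Dx u; have := expR_ge1Dx (- u).
by have := expR_ge0 u; have := expR_ge0 (- u); case: (ger0P u) => *; lra.
Qed.

(** The difference quotient at 0 of the exponential in direction [u]; the next lemmas squeeze it to
    [u] and bound it uniformly in [t]. *)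
Let dd (u t : R) : R := (expR (t * u) - 1) / t.

Let dd_ge (u t : R) : 0 < t -> u <= dd u t.
Proof.
by move=> t0; rewrite ler_pdivlMr// lerBrDl mulrC expR_ge1Dx.
Qed.

(** Multiply 1 - t u <= exp(- t u) by exp(t u). *)
Let dd_le (u t : R) : 0 < t -> dd u t <= u * expR (t * u).
Proof.
move=> t0; rewrite ler_pdivrMr//.
have : 1 - t * u <= expR (- (t * u)) by rewrite expR_ge1Dx.
move=> /(ler_wpM2l (expR_ge0 (t * u))).
by rewrite -expRD subrr expR0 => *; nra.
Qed.

Let dd_bound (u t : R) : 0 < t <= 1 -> `|dd u t| <= expR (2 * u) + expR (- 2 * u).
Proof.
move=> /andP[t0 t1].
have := dd_ge u t0; have := dd_le u t0.
have := expR_ge1Dx u; have := expR_ge1Dx (- u).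
have e1 : expR (2 * u) = expR u * expR u by rewrite -expRD; congr expR; ring.
have e2 : expR (- 2 * u) = expR (- u) * expR (- u).
  by rewrite -expRD; congr expR; ring.
have := expR_gt0 u; have := expR_gt0 (- u).
have [u0|u0] := leP 0 u.
  have : expR (t * u) <= expR u by rewrite ler_expR; nra.
  by have := expR_gt0 (t * u); rewrite e1 e2 ler_norml => *; apply/andP; split; nra.
have : expR (t * u) <= 1 by rewrite -expR0 ler_expR; nra.
by have := expR_gt0 (t * u); rewrite e1 e2 ler_norml => *; apply/andP; split; nra.
Qed.

Let dd_cvg (u : R) : dd u k.+1%:R^-1 @[k --> \oo] --> u.
Proof.
apply: (@squeeze_cvgr _ _ _ _ (fun=> u) (fun k => u * expR (k.+1%:R^-1 * u))).
- by near=> k; rewrite dd_ge// dd_le.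
- exact: cvg_cst.
- have -> : nbhs u = nbhs (u * expR (0 * u)) by rewrite mul0r expR0 mulr1.
  apply: cvgM; first exact: cvg_cst.
  apply: continuous_cvg; first exact: continuous_expR.
  apply: cvgM; last exact: cvg_cst.
  exact: (@cvg_harmonic R).
Unshelve. all: by end_near. Qed.

Context d (T : measurableType d) (m : {measure set T -> \bar R}).

(** The conclusion is the derivative at t = 0 of an integral that vanishes for every [t]. Dominated
    convergence applies to the difference quotients [F k] at t = 1/(k+1). *)
Lemma Rintegral_mul_eq0 (G U : T -> R) :
  measurable_fun setT U ->
  (forall t, m.-integrable setT (EFin \o (fun x => G x * expR (t * U x)))) ->
  (forall t, \int[m]_x (G x * expR (t * U x)) = 0) ->
  \int[m]_x (G x * U x) = 0.
Proof.
move=> mU iG G0.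
have iG0 : m.-integrable setT (EFin \o G).
  by apply: eq_integrable (iG 0) => // x _ /=; rewrite mul0r expR0 mulr1.
have mG : measurable_fun setT G by exact/measurable_EFinP/(measurable_int m).
have iN t : m.-integrable setT (EFin \o (fun x => `|G x| * expR (t * U x))).
  apply: eq_integrable (integrable_norm (iG t)) => // x _ /=.
  by rewrite normrM (ger0_norm (expR_ge0 _)).
pose F k x := G x * dd (U x) k.+1%:R^-1.
pose H x := `|G x| * expR (2 * U x) + `|G x| * expR (- 2 * U x).
have mF k : measurable_fun setT (F k).
  apply: measurable_funM => //; apply: measurable_funM => //.
  apply: measurable_funB => //; apply: measurableT_comp => //.
  exact: measurable_funM.
(* [F k] is k+1 times the difference of the integrands for t = 1/(k+1) and t = 0, and both have
   integral 0. *)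
have F0 k : (\int[m]_x (F k x)%:E = 0)%E.
  have t0 : k.+1%:R^-1 != 0 :> R by rewrite invr_eq0.
  have FE x : (F k x)%:E =
      ((k.+1%:R)%:E * (G x * expR (k.+1%:R^-1 * U x) - G x)%:E)%E.
    by rewrite -EFinM /F /dd invrK; congr EFin; ring.
  under eq_integral do rewrite FE.
  rewrite integralZl//; last first.
    by apply: eq_integrable (integrableB measurableT (iG _) iG0).
  rewrite integralB_EFin//.
  rewrite -(fineK (integrable_fin_num _ (iG _)))// -(fineK (integrable_fin_num _ iG0))//.
  have := G0 k.+1%:R^-1; have := G0 0.
  rewrite /Rintegral; under eq_integral do rewrite mul0r expR0 mulr1.
  by move=> -> ->; rewrite subee// mule0.
have cvF x : (F k x)%:E @[k --> \oo] --> (G x * U x)%:E.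
  apply: cvg_EFin; first exact: nearW.
  by apply: cvgM; [exact: cvg_cst|exact: dd_cvg].
(* The dominating function comes from [dd_bound]; it is integrable by the hypothesis at t = 2 and t
   = -2. *)
have iH : m.-integrable setT (EFin \o H).
  by apply: eq_integrable (integrableD measurableT (iN 2) (iN (- 2))).
have FH k x : (`|(F k x)%:E| <= (H x)%:E)%E.
  rewrite lee_fin normrM /H -mulrDr ler_wpM2l//; apply: dd_bound.
  by rewrite invr_gt0 ltr0n invf_le1 ?ler1n ?ltr0n.
have [_ _] := dominated_convergence measurableT
  (fun k => (measurable_EFinP _ _).2 (mF k))
  ((measurable_EFinP _ _).2 (measurable_funM mG mU))
  (aeW _ (fun x _ => cvF x)) iH (aeW _ (fun x k _ => FH k x)).
rewrite (_ : [sequence _]_k = fun=> 0%E); last by apply/funext => k; exact: F0.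
by move=> /(cvg_unique _ (cvg_cst _)); rewrite /Rintegral => <-.
Qed.

End moment.

(** * Elementary rules for conditional expectation given an event *)

Section conditional_expectation.
Context d (T : measurableType d) (R : realType) (P : probability T R).
Context (B : set T).
Hypotheses (mB : measurable B) (B_gt0 : (0 < P B)%E).
Implicit Types f g : T -> R.
Local Notation integrable f := (P.-integrable setT (EFin \o f)).

Lemma cond_expE f : cond_exp P B f = (\int[P]_(w in B) f w) / fine (P B).
Proof. by []. Qed.

Lemma cond_exp_setT f : cond_exp P setT f = \int[P]_w f w.
Proof. by rewrite /cond_exp probability_setT divr1. Qed.

Lemma cond_exp_indic f :
  cond_exp P B f = (\int[P]_w (\1_B w * f w)) / fine (P B).
Proof.
rewrite cond_expE Rintegral_mkcond; congr (_ / _).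
by apply: eq_Rintegral => w _; rewrite patch_indic/= mulrC.
Qed.

Let integrableB f : integrable f -> P.-integrable B (EFin \o f).
Proof. exact: integrableS. Qed.

Let integrableZ k f : integrable f -> integrable (fun w => k * f w).
Proof. by move=> fi; apply: eq_integrable (integrableZl measurableT k fi). Qed.

Let integrable_add f g : integrable f -> integrable g ->
  integrable (fun w => f w + g w).
Proof.
by move=> fi gi; apply: eq_integrable (integrableD measurableT fi gi).
Qed.

Let integrable_cst k : integrable (fun=> k).
Proof. exact: finite_measure_integrable_cst. Qed.

Lemma cond_expD f g : integrable f -> integrable g ->
  cond_exp P B (fun w => f w + g w) = cond_exp P B f + cond_exp P B g.
Proof.
by move=> /integrableB fi /integrableB gi; rewrite !cond_expE RintegralD// mulrDl.
Qed.

Lemma cond_expZ k f : integrable f ->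
  cond_exp P B (fun w => k * f w) = k * cond_exp P B f.
Proof. by move=> /integrableB fi; rewrite !cond_expE RintegralZl// mulrA. Qed.

Lemma fine_probability_gt0 : 0 < fine (P B).
Proof. by rewrite fine_gt0// B_gt0 (le_lt_trans (probability_le1 _ _)) ?ltry. Qed.

Lemma cond_exp_cst k : cond_exp P B (fun=> k) = k.
Proof.
by rewrite cond_expE Rintegral_cst// mulfK// gt_eqF// fine_probability_gt0.
Qed.

Lemma cond_exp_centeredM f g :
  integrable f -> integrable g -> integrable (fun w => f w * g w) ->
  cond_exp P B (fun w => (f w - cond_exp P B f) * (g w - cond_exp P B g)) =
  cond_exp P B (fun w => f w * g w) - cond_exp P B f * cond_exp P B g.
Proof.
move=> fi gi fgi; set u := cond_exp P B f; set v := cond_exp P B g.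
transitivity (cond_exp P B (fun w => f w * g w + ((- v) * f w + ((- u) * g w + u * v)))).
  by congr (cond_exp P B); apply/funext => w; ring.
rewrite cond_expD//; last exact: (integrable_add (integrableZ _ fi) (integrable_add (integrableZ _ gi) (integrable_cst _))).
rewrite cond_expD//; [|exact: integrableZ|exact: (integrable_add (integrableZ _ gi) (integrable_cst _))].
rewrite cond_expD//; last exact: integrableZ.
by rewrite cond_exp_cst (cond_expZ _ fi) (cond_expZ _ gi) -/u -/v; ring.
Qed.

Lemma cond_exp_ge0 f : (forall w, 0 <= f w) -> 0 <= cond_exp P B f.
Proof.
by move=> f0; apply: divr_ge0; [exact: Rintegral_ge0|exact: fine_ge0].
Qed.

(** This settles the degenerate case of the division by the variance in beta. The nonnegative (f -
    m)^2 has integral 0, hence also integral 0 over [B]. Its conditional mean is the conditional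
    variance plus (u - m)^2, with [u] the conditional mean of [f], so both summands vanish. *)
Lemma cond_var_eq0 f : integrable f -> integrable (fun w => f w * f w) ->
  cond_var P setT f = 0 -> cond_var P B f = 0.
Proof.
move=> fi ffi; rewrite /cond_var cond_exp_setT; set m := cond_exp P setT f.
pose q w := (f w - m) ^+ 2; rewrite -/q => q0.
have qE : q = (fun w => f w * f w + ((- 2 * m) * f w + m ^+ 2)).
  by apply/funext => w; rewrite /q; ring.
have li : integrable (fun w => (- 2 * m) * f w + m ^+ 2).
  exact: (integrable_add (integrableZ _ fi) (integrable_cst _)).
have qi : integrable q by rewrite qE; exact: (integrable_add ffi li).
have intq0 : (\int[P]_w (q w)%:E = 0)%E.
  by rewrite -(fineK (integrable_fin_num _ qi))//; congr EFin.
have qB0 : cond_exp P B q = 0.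
  rewrite cond_expE [X in X / _](_ : _ = 0) ?mul0r//.
  rewrite /Rintegral [X in fine X](_ : _ = 0%E)//; apply/eqP.
  rewrite eq_le integral_ge0 ?andbT => [|w _]; last by rewrite lee_fin sqr_ge0.
  rewrite -intq0; apply: ge0_subset_integral => //.
    exact: (measurable_int P qi).
  by move=> w _; rewrite lee_fin sqr_ge0.
have := qB0; rewrite qE (cond_expD ffi li).
rewrite (cond_expD (integrableZ _ fi) (integrable_cst _)) (cond_expZ _ fi) cond_exp_cst.
have v0 : 0 <= cond_exp P B (fun w => (f w - cond_exp P B f) ^+ 2).
  by apply: cond_exp_ge0 => w; exact: sqr_ge0.
(* A square is convertible to the product of two equal factors, so the centred product is read as
   the conditional variance. *)
have := cond_exp_centeredM fi fi ffi; rewrite -[cond_exp P B (fun w => _ * _)]/(cond_exp P B (fun w => (f w - cond_exp P B f) ^+ 2)).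
move: v0; set v := cond_exp P B (fun w => _ ^+ 2); set u := cond_exp P B f.
move=> v0 vE uE; apply/eqP; rewrite eq_le v0 andbT.
by have := sqr_ge0 (u - m); nra.
Qed.

End conditional_expectation.

(** Unconditional covariances become conditional ones given [setT], so that one formula serves both
    sides of the theorem. *)
Lemma covariance_cond_exp d (T : measurableType d) (R : realType)
    (P : probability T R) (F G : T -> R) :
  fine (covariance P F G) =
  cond_exp P setT (fun w => (F w - cond_exp P setT F) * (G w - cond_exp P setT G)).
Proof.
by rewrite !cond_exp_setT covariance.unlock expectation.unlock.
Qed.

(** * Exponential tilting of a Gaussian vector *)

Section gaussian_vector.
Context {R : realType} d (T : measurableType d) (P : probability T R) (n : nat).
Context (mu : 'cV[R]_n) (Sigma : 'M[R]_n) (xi : {RV P >-> n.-tuple R}).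
Hypothesis Sigma_posdef : posdefmx Sigma.
Hypothesis xi_normal : forall A : set (n.-tuple R), measurable A ->
  distribution P xi A = mvnormal mu Sigma A.

Local Notation L c w := ((c *m colvec (xi w)) 0 0).

Lemma measurable_lin (c : 'rV[R]_n) : measurable_fun setT (fun w => L c w).
Proof. exact: (measurableT_comp (measurable_mulmx_colvec c)). Qed.

Lemma ge0_integral_normal (f : n.-tuple R -> \bar R) :
  measurable_fun setT f -> (forall x, 0 <= f x)%E ->
  (\int[P]_w f (xi w) =
   \int[lebesgue_tuple n]_x (f x * (mvnormal_pdf mu Sigma (colvec x))%:E))%E.
Proof.
move=> mf f0; rewrite -(ge0_integral_distribution xi)//.
apply: (@ge0_integral_density _ _ _ (distribution P xi) (lebesgue_tuple n)) => //.
- by apply/measurable_EFinP; exact: measurable_mvnormal_pdf.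
- by move=> x; rewrite lee_fin mvnormal_pdf_ge0.
Qed.

(** A Cameron-Martin formula: weighting by exp(c X) shifts the vector by [Sigma *m c^T], up to the
    constant [k]. *)
Lemma ge0_integral_normal_tilt (c : 'rV[R]_n) (f : n.-tuple R -> \bar R) :
  measurable_fun setT f -> (forall x, 0 <= f x)%E ->
  (\int[P]_w (f (xi w) * (expR (L c w))%:E) =
   (expR ((c *m mu) 0 0 + (c *m Sigma *m c^T) 0 0 / 2))%:E *
   \int[P]_w f (addt [tuple (Sigma *m c^T) i ord0 | i < n] (xi w)))%E.
Proof.
move=> mf f0; set v := [tuple _ | _ < _]; set k := expR _.
have vE : colvec v = Sigma *m c^T by apply/colP => i; rewrite !mxE tnth_mktuple mxE.
have mpdf := measurable_mvnormal_pdf mu Sigma.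
have mexp : measurable_fun setT (fun x : n.-tuple R => expR ((c *m colvec x) 0 0)).
  exact: measurableT_comp (measurable_mulmx_colvec c).
rewrite (@ge0_integral_normal (fun x => f x * (expR ((c *m colvec x) 0 0))%:E)%E); last 2 first.
- by apply: emeasurable_funM => //; exact/measurable_EFinP.
- by move=> x; rewrite mule_ge0 ?lee_fin ?expR_ge0.
rewrite (@ge0_integral_normal (fun x => f (addt v x))) => //; last first.
  exact: (measurableT_comp mf (measurable_addt v)).
(* Both sides reduce to the integral of [F]: translating by [v] gives the integral on the right, and
   [FE] gives the left one divided by [k]. *)
pose F x := (f x * (mvnormal_pdf mu Sigma (colvec x - Sigma *m c^T))%:E)%E.
have FE x : F x = ((k^-1)%:E *
    (f x * (expR ((c *m colvec x) 0 0))%:E * (mvnormal_pdf mu Sigma (colvec x))%:E))%E.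
  rewrite /F mvnormal_pdf_shift// -!muleA -EFinM muleCA -EFinM; congr (_ * _%:E)%E.
  rewrite [RHS]mulrA [RHS]mulrC -expRN -expRD mulmxBr; congr (_ * expR _).
  by rewrite !mxE; lra.
have F0 x : (0 <= F x)%E by rewrite mule_ge0// lee_fin mvnormal_pdf_ge0.
have mF : measurable_fun setT F.
  apply: emeasurable_funM => //; apply/measurable_EFinP.
  (* The shifted density is the normal density with a shifted mean. *)
  rewrite (_ : (fun x => _) = (fun x : n.-tuple R => mvnormal_pdf (mu + Sigma *m c^T) Sigma (colvec x))).
    exact: measurable_mvnormal_pdf.
  by apply/funext => x; rewrite /mvnormal_pdf opprD addrA addrAC.
have <- : (\int[lebesgue_tuple n]_x F x = \int[lebesgue_tuple n]_x
    (f (addt v x) * (mvnormal_pdf mu Sigma (colvec x))%:E))%E.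
  rewrite -(ge0_integral_translation v mF F0).
  by apply: eq_integral => x _; rewrite /F colvec_addt vE [X in X - _]addrC addrK.
rewrite -ge0_integralZl_EFin ?expR_ge0//.
apply: eq_integral => x _; rewrite FE muleA -EFinM divff ?mul1e//.
by rewrite gt_eqF// expR_gt0.
Qed.

(** The moment generating function, obtained by tilting the constant 1. *)
Lemma integral_expR_lin (c : 'rV[R]_n) :
  (\int[P]_w (expR (L c w))%:E =
   (expR ((c *m mu) 0 0 + (c *m Sigma *m c^T) 0 0 / 2))%:E)%E.
Proof.
transitivity (\int[P]_w (cst 1 (xi w) * (expR (L c w))%:E))%E.
  by apply: eq_integral => w _; rewrite mul1e.
rewrite (@ge0_integral_normal_tilt c (cst 1%E))//.
rewrite integral_cst// mul1e [X in (_ * X)%E](_ : _ = 1%E) ?mule1//.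
exact: probability_setT.
Qed.

Lemma integrable_expR_lin (c : 'rV[R]_n) :
  P.-integrable setT (EFin \o (fun w => expR (L c w))).
Proof.
apply/integrableP; split.
  by apply/measurable_EFinP; apply: measurableT_comp => //; exact: measurable_lin.
under eq_integral do rewrite gee0_abs ?lee_fin ?expR_ge0//.
by rewrite integral_expR_lin ltry.
Qed.

Lemma ge0_integral_tilt_indep (c : 'rV[R]_n) (a : 'rV[R]_n) (h : R -> R) :
  measurable_fun setT h -> (forall x, 0 <= h x) ->
  a *m Sigma *m c^T = 0 ->
  (\int[P]_w (h (L a w) * expR (L c w))%:E =
   \int[P]_w (expR (L c w))%:E * \int[P]_w (h (L a w))%:E)%E.
Proof.
move=> mh h0 ac.
rewrite integral_expR_lin; under eq_integral do rewrite EFinM.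
rewrite (@ge0_integral_normal_tilt c (fun x => (h ((a *m colvec x) 0 0))%:E)); last 2 first.
- by apply/measurable_EFinP; exact: (measurableT_comp mh (measurable_mulmx_colvec a)).
- by move=> x; rewrite lee_fin.
rewrite [X in (_ * X)%E](_ : _ = \int[P]_w (h (L a w))%:E)%E//.
apply: eq_integral => w _; rewrite colvec_addt mulmxDr.
rewrite (_ : colvec _ = Sigma *m c^T) ?mulmxA ?ac ?add0r//.
by apply/colP => i; rewrite !mxE tnth_mktuple mxE.
Qed.

Lemma linDZ (c e : 'rV[R]_n) t w : L (e + t *: c) w = L e w + t * L c w.
Proof. by rewrite mulmxDl -scalemxAl !mxE. Qed.

(** This class provides every integrability condition met when differentiating in [c], and it is
    stable under sums, indicators and products with linear forms. *)
Definition tempered (G : T -> R) :=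
  forall c : 'rV[R]_n, P.-integrable setT (EFin \o (fun w => G w * expR (L c w))).

Lemma tempered_integrable G : tempered G -> P.-integrable setT (EFin \o G).
Proof.
move=> /(_ 0); apply: eq_integrable => // w _ /=.
by rewrite mul0mx mxE expR0 mulr1.
Qed.

Lemma tempered_measurable G : tempered G -> measurable_fun setT G.
Proof.
by move=> /tempered_integrable/(measurable_int P)/measurable_EFinP.
Qed.

Lemma tempered_cst k : tempered (fun=> k).
Proof.
by move=> c; apply: eq_integrable (integrableZl measurableT k (integrable_expR_lin c)).
Qed.

Lemma temperedD F G : tempered F -> tempered G -> tempered (fun w => F w + G w).
Proof.
move=> tF tG c; apply: eq_integrable (integrableD measurableT (tF c) (tG c)) => //.
by move=> w _ /=; rewrite mulrDl EFinD.
Qed.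

Lemma temperedZ k G : tempered G -> tempered (fun w => k * G w).
Proof.
move=> tG c; apply: eq_integrable (integrableZl measurableT k (tG c)) => //.
by move=> w _ /=; rewrite -mulrA EFinM.
Qed.

Lemma tempered_indic B G : measurable B -> tempered G ->
  tempered (fun w => \1_B w * G w).
Proof.
move=> mB tG c; apply: le_integrable (tG c) => //.
  apply/measurable_EFinP; apply: measurable_funM.
    by apply: measurable_funM => //; exact: tempered_measurable.
  by apply: measurableT_comp => //; exact: measurable_lin.
move=> w _; rewrite /= lee_fin -mulrA normrM ler_piMl//.
by rewrite indicE; case: (w \in B); rewrite ?normr1 ?normr0.
Qed.

(** Since |u| <= exp(u) + exp(-u), the factor [L c] is absorbed by the two tilts [c' + c] and
    [c' - c]. *)
Lemma temperedM_lin (c : 'rV[R]_n) G : tempered G -> tempered (fun w => G w * L c w).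
Proof.
move=> tG c'.
have tN (e : 'rV[R]_n) : P.-integrable setT (EFin \o (fun w => `|G w| * expR (L e w))).
  apply: eq_integrable (integrable_norm (tG e)) => // w _ /=.
  by rewrite normrM (ger0_norm (expR_ge0 _)).
apply: le_integrable (integrableD measurableT (tN (c' + c)) (tN (c' - c))) => //.
  apply/measurable_EFinP; apply: measurable_funM.
    by apply: measurable_funM; [exact: tempered_measurable|exact: measurable_lin].
  by apply: measurableT_comp => //; exact: measurable_lin.
move=> w _ /=; rewrite lee_fin -mulrDr -mulrA normrM.
rewrite [leRHS]ger0_norm ?mulr_ge0 ?addr_ge0 ?expR_ge0// ler_wpM2l//.
rewrite normrM (ger0_norm (expR_ge0 _)) mulrC.
rewrite -[c in c' + c]scale1r -scaleN1r !linDZ mul1r mulN1r.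
by rewrite !expRD -mulrDr ler_wpM2l ?expR_ge0// expR_ge_norm.
Qed.

(** Both |h| and |h| + h are nonnegative, so the nonnegative case applies to each; subtracting gives
    the signed case. *)
Lemma Rintegral_tilt_indep (c a : 'rV[R]_n) (h : R -> R) :
  measurable_fun setT h -> a *m Sigma *m c^T = 0 ->
  tempered (fun w => h (L a w)) ->
  \int[P]_w (h (L a w) * expR (L c w)) =
  \int[P]_w expR (L c w) * \int[P]_w h (L a w).
Proof.
move=> mh ac th.
have tN : tempered (fun w => `|h (L a w)|).
  move=> e; apply: eq_integrable (integrable_norm (th e)) => // w _ /=.
  by rewrite normrM (ger0_norm (expR_ge0 _)).
have tS := temperedD tN th.
have ie := integrable_expR_lin c.
have ge0E (k : R -> R) : measurable_fun setT k -> (forall x, 0 <= k x) ->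
    tempered (fun w => k (L a w)) ->
    \int[P]_w (k (L a w) * expR (L c w)) =
    \int[P]_w expR (L c w) * \int[P]_w k (L a w).
  move=> mk k0 tk; rewrite /Rintegral ge0_integral_tilt_indep// fineM//.
    exact: integrable_fin_num.
  exact: (integrable_fin_num _ (tempered_integrable tk)).
have mN : measurable_fun setT (fun x => `|h x|) by exact: measurableT_comp.
have mS : measurable_fun setT (fun x => `|h x| + h x) by exact: measurable_funD.
have S0 x : 0 <= `|h x| + h x by have := ler_norm (- h x); rewrite normrN; lra.
have EN := ge0E _ mN (fun=> normr_ge0 _) tN.
have e1 : \int[P]_w ((`|h (L a w)| + h (L a w)) * expR (L c w)) =
    \int[P]_w (`|h (L a w)| * expR (L c w)) + \int[P]_w (h (L a w) * expR (L c w)).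
  under eq_Rintegral do rewrite mulrDl.
  exact: (RintegralD measurableT (tN c) (th c)).
have e2 : \int[P]_w (`|h (L a w)| + h (L a w)) =
    \int[P]_w `|h (L a w)| + \int[P]_w h (L a w).
  exact: (RintegralD measurableT (tempered_integrable tN) (tempered_integrable th)).
by have := ge0E _ mS S0 tS; rewrite /= e1 e2 EN mulrDr => /addrI.
Qed.

(** * Factorization of first and second moments *)

Section independence.
Context (a : 'rV[R]_n).

(* Differentiates the hypothesis in the direction [c]; the conclusion has the
   same shape, so the step can be repeated with another direction. *)
Lemma Rintegral_tiltM_eq0 (G : T -> R) (c : 'rV[R]_n) : tempered G ->
  (forall e : 'rV[R]_n, a *m Sigma *m e^T = 0 -> \int[P]_w (G w * expR (L e w)) = 0) ->
  a *m Sigma *m c^T = 0 ->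
  forall e : 'rV[R]_n, a *m Sigma *m e^T = 0 ->
    \int[P]_w (G w * L c w * expR (L e w)) = 0.
Proof.
move=> tG G0 ac e ae.
under eq_Rintegral do rewrite mulrAC.
have tE t w : G w * expR (L e w) * expR (t * L c w) =
    G w * expR (L (e + t *: c) w).
  by rewrite linDZ expRD mulrA.
apply: Rintegral_mul_eq0 => [|t|t].
- exact: measurable_lin.
- by apply: eq_integrable (tG (e + t *: c)) => // w _ /=; rewrite tE.
- under eq_Rintegral do rewrite tE.
  by apply: G0; rewrite linearD/= linearZ/= mulmxDr ae -scalemxAr ac scaler0 addr0.
Qed.

(** Centring h(Y) turns the factorization into a vanishing integral, the form that can be
    differentiated. *)
Let centered_tilt0 (h : R -> R) : measurable_fun setT h ->
  tempered (fun w => h (L a w)) ->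
  forall c : 'rV[R]_n, a *m Sigma *m c^T = 0 ->
  \int[P]_w ((h (L a w) + - \int[P]_w h (L a w)) * expR (L c w)) = 0.
Proof.
move=> mh th c ac; set m := \int[P]_w h (L a w).
under eq_Rintegral do rewrite mulrDl.
rewrite (RintegralD measurableT (th c) (tempered_cst _ c)).
rewrite RintegralZl//; last exact: integrable_expR_lin.
by rewrite Rintegral_tilt_indep// -/m; ring.
Qed.

Lemma Rintegral_indep1 (h : R -> R) (c : 'rV[R]_n) : measurable_fun setT h ->
  tempered (fun w => h (L a w)) -> a *m Sigma *m c^T = 0 ->
  \int[P]_w (h (L a w) * L c w) = \int[P]_w h (L a w) * \int[P]_w L c w.
Proof.
move=> mh th ac.
have tc : tempered (fun w => L c w).
  by have := temperedM_lin c (tempered_cst 1); under eq_fun do rewrite mul1r.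
have tG := temperedD th (tempered_cst (- \int[P]_w h (L a w))).
(* Evaluation at [e := 0] removes the exponential once the derivative is taken. *)
have := Rintegral_tiltM_eq0 tG (centered_tilt0 mh th) ac (e := 0).
rewrite trmx0 mulmx0 => /(_ erefl).
under eq_Rintegral do rewrite mul0mx [X in expR X]mxE expR0 mulr1 mulrDl.
rewrite (RintegralD measurableT (tempered_integrable (temperedM_lin c th))
  (tempered_integrable (temperedZ _ tc))).
rewrite RintegralZl//; last exact: tempered_integrable.
by move/eqP; rewrite mulNr subr_eq0 => /eqP.
Qed.

Lemma Rintegral_indep2 (h : R -> R) (c e : 'rV[R]_n) : measurable_fun setT h ->
  tempered (fun w => h (L a w)) ->
  a *m Sigma *m c^T = 0 -> a *m Sigma *m e^T = 0 ->
  \int[P]_w (h (L a w) * (L c w * L e w)) =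
  \int[P]_w h (L a w) * \int[P]_w (L c w * L e w).
Proof.
move=> mh th ac ae.
have tce : tempered (fun w => L c w * L e w).
  have := temperedM_lin e (temperedM_lin c (tempered_cst 1)).
  by under eq_fun do rewrite mul1r.
have tG := temperedD th (tempered_cst (- \int[P]_w h (L a w))).
have tGc := temperedM_lin c tG.
(* Two derivatives, in direction [c] and then [e], evaluated without a remaining tilt. *)
have := Rintegral_tiltM_eq0 tGc (Rintegral_tiltM_eq0 tG (centered_tilt0 mh th) ac) ae (e := 0).
rewrite trmx0 mulmx0 => /(_ erefl).
under eq_Rintegral do rewrite mul0mx [X in expR X]mxE expR0 mulr1 -mulrA mulrDl.
have thce : tempered (fun w => h (L a w) * (L c w * L e w)).
  have := temperedM_lin e (temperedM_lin c th).
  by under eq_fun do rewrite -mulrA.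
rewrite (RintegralD measurableT (tempered_integrable thce)
  (tempered_integrable (temperedZ _ tce))).
rewrite RintegralZl//; last exact: tempered_integrable.
by move/eqP; rewrite mulNr subr_eq0 => /eqP.
Qed.

End independence.

Lemma tempered_lin (c : 'rV[R]_n) : tempered (fun w => L c w).
Proof.
have := temperedM_lin c (tempered_cst 1).
by under eq_fun do rewrite mul1r.
Qed.

(** * Conditional covariance of linear forms given Y in B1 *)

Section conditional_covariance.
Context (a : 'rV[R]_n) (B1 : set R).
Hypothesis mB1 : measurable B1.
Let B : set T := (fun w => L a w) @^-1` B1.
Hypothesis B_gt0 : (0 < P B)%E.

Let mB : measurable B.
Proof. by rewrite /B -[X in measurable X]setTI; exact: measurable_lin. Qed.

Let indicB w : \1_B w = \1_B1 (L a w) :> R.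
Proof. by rewrite !indicE; congr (_%:R); apply/idP/idP; rewrite !inE. Qed.

Let Rintegral_indicB : \int[P]_w \1_B1 (L a w) = fine (P B).
Proof.
under eq_Rintegral do rewrite -indicB.
by rewrite /Rintegral integral_indic// setIT.
Qed.

Let p_neq0 : fine (P B) != 0.
Proof. by rewrite gt_eqF// fine_probability_gt0. Qed.

Let tempered_indicB : tempered (fun w => \1_B1 (L a w)).
Proof.
have := tempered_indic mB (tempered_cst 1).
by under eq_fun do rewrite mulr1 indicB.
Qed.

Let tempered_indicBY : tempered (fun w => \1_B1 (L a w) * L a w).
Proof.
have := tempered_indic mB (tempered_lin a).
by under eq_fun do rewrite indicB.
Qed.

Let cond_exp_lin (c : 'rV[R]_n) : a *m Sigma *m c^T = 0 ->
  cond_exp P B (fun w => L c w) = \int[P]_w L c w.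
Proof.
move=> ac; rewrite cond_exp_indic//.
under eq_Rintegral do rewrite indicB.
rewrite (@Rintegral_indep1 a (\1_B1))//.
by rewrite Rintegral_indicB mulrC mulKf.
Qed.

Let cond_exp_linM (c e : 'rV[R]_n) :
  a *m Sigma *m c^T = 0 -> a *m Sigma *m e^T = 0 ->
  cond_exp P B (fun w => L c w * L e w) = \int[P]_w (L c w * L e w).
Proof.
move=> ac ae; rewrite cond_exp_indic//.
under eq_Rintegral do rewrite indicB.
rewrite (@Rintegral_indep2 a (\1_B1))//.
by rewrite Rintegral_indicB mulrC mulKf.
Qed.

Let cond_exp_Ylin (c : 'rV[R]_n) : a *m Sigma *m c^T = 0 ->
  cond_exp P B (fun w => L a w * L c w) =
  cond_exp P B (fun w => L a w) * \int[P]_w L c w.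
Proof.
move=> ac; rewrite !cond_exp_indic//.
under eq_Rintegral do rewrite indicB mulrA.
(* The factor Y is absorbed into the function of Y that multiplies the linear form. *)
rewrite (@Rintegral_indep1 a (fun y => \1_B1 y * y))//; last first.
  exact: measurable_funM.
under [in RHS]eq_Rintegral do rewrite indicB.
by rewrite mulrAC.
Qed.

(** The event enters the right-hand side only through the conditional variance of Y, so changing the
    event changes only that term. *)
Lemma cond_cov_lin (c e : 'rV[R]_n) (b b' : R) :
  a *m Sigma *m c^T = 0 -> a *m Sigma *m e^T = 0 ->
  let F w := L (c + b *: a) w in let G w := L (e + b' *: a) w in
  cond_exp P B (fun w => (F w - cond_exp P B F) * (G w - cond_exp P B G)) =
  \int[P]_w (L c w * L e w) - \int[P]_w L c w * \int[P]_w L e w +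
  b * b' * cond_var P B (fun w => L a w).
Proof.
move=> ac ae F G.
have ti := tempered_integrable; have tl := tempered_lin.
have tll (u v : 'rV[R]_n) := temperedM_lin v (tl u).
have -> : cond_var P B (fun w => L a w) =
    cond_exp P B (fun w => L a w * L a w) -
    cond_exp P B (fun w => L a w) * cond_exp P B (fun w => L a w).
  by rewrite -(cond_exp_centeredM mB B_gt0 (ti _ (tl a)) (ti _ (tl a)) (ti _ (tll a a))).
rewrite (cond_exp_centeredM mB B_gt0 (ti _ (tl _)) (ti _ (tl _)) (ti _ (tll _ _))).
have ceF (u : 'rV[R]_n) t : a *m Sigma *m u^T = 0 ->
    cond_exp P B (fun w => L (u + t *: a) w) =
    \int[P]_w L u w + t * cond_exp P B (fun w => L a w).
  move=> au; transitivity (cond_exp P B (fun w => L u w + t * L a w)).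
    by congr (cond_exp P B); apply/funext => w; exact: linDZ.
  rewrite (cond_expD mB (ti _ (tl u)) (ti _ (temperedZ t (tl a)))).
  by rewrite (cond_expZ mB t (ti _ (tl a))) cond_exp_lin.
rewrite /F /G !ceF//.
have -> : (fun w => L (c + b *: a) w * L (e + b' *: a) w) =
   (fun w => L c w * L e w + (b' * (L a w * L c w) +
             (b * (L a w * L e w) + b * b' * (L a w * L a w)))).
  by apply/funext => w; rewrite !linDZ; ring.
have tZ t u v := temperedZ t (tll u v).
have t3 := tZ (b * b') a a; have t2 := temperedD (tZ b a e) t3.
rewrite (cond_expD mB (ti _ (tll c e)) (ti _ (temperedD (tZ b' a c) t2))).
rewrite (cond_expD mB (ti _ (tZ b' a c)) (ti _ t2)).
rewrite (cond_expD mB (ti _ (tZ b a e)) (ti _ t3)).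
rewrite (cond_expZ mB b' (ti _ (tll a c))) (cond_expZ mB b (ti _ (tll a e))).
rewrite (cond_expZ mB (b * b') (ti _ (tll a a))).
(* The mixed terms in [b] and in [b'] cancel against those of the product of the two means. *)
by rewrite cond_exp_linM// (cond_exp_Ylin ac) (cond_exp_Ylin ae); ring.
Qed.

End conditional_covariance.

End gaussian_vector.

(** * The matrix identity, assembled entry by entry *)

Theorem corollary5p1 (R : realType) (d : measure_display) (T : measurableType d)
    (P : probability T R) (n : nat) (mu : 'cV[R]_n) (Sigma : 'M[R]_n)
    (Sigma_posdef : posdefmx Sigma)
    (xi : {RV P >-> n.-tuple R})
    (xi_normal : forall A : set (n.-tuple R), measurable A ->
       distribution P xi A = mvnormal mu Sigma A)
    (a : 'rV[R]_n) (a_neq0 : a != 0)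
    (B1 : set R) (mB1 : measurable B1) :
  let X : T -> 'cV[R]_n := fun w => colvec (xi w) in
  let Y : T -> R := fun w => (a *m X w) 0 0 in
  let B : set T := Y @^-1` B1 in
  (0 < P B)%E ->
  let beta : 'cV[R]_n :=
    \col_i (fine (covariance P Y (fun w => X w i 0)) / fine 'V_P[Y]) in
  cond_varmx P B X =
  covmx P X + (cond_var P B Y - fine 'V_P[Y]) *: (beta *m beta^T).
Proof.
move=> X Y B B_gt0 beta.
have [St Sp] := Sigma_posdef.
pose s := (a *m Sigma *m a^T) 0 0.
have s0 : s != 0.
  have at0 : a^T != 0 by rewrite -(inj_eq (@trmx_inj _ _ _)) trmxK trmx0.
  by have := Sp _ at0; rewrite trmxK lt0r => /andP[].
(* [b i] is the coefficient that makes [c i] orthogonal to [a] with respect to [Sigma]. It is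
   compared with beta_i through [covYX], without computing the variance of Y. *)
pose b i := (a *m Sigma) 0 i / s.
pose c i : 'rV[R]_n := delta_mx 0 i - b i *: a.
have ac i : a *m Sigma *m (c i)^T = 0.
  rewrite linearB/= linearZ/= trmx_delta mulmxBr -scalemxAr -colE.
  rewrite [a *m _ *m _]mx11_scalar -/s scale_scalar_mx mulfVK//.
  by rewrite [X in X - _]mx11_scalar [col _ _ _ _]mxE subrr.
have XE i : (fun w => X w i 0) = (fun w => ((c i + b i *: a) *m X w) 0 0).
  by apply/funext => w; rewrite subrK -rowE [RHS]mxE.
(* Written with residual form 0 and coefficient 1, Y fits [cond_cov_lin], which then yields its
   covariance with X_i. *)
have YE : Y = (fun w => ((0 + 1 *: a) *m X w) 0 0).
  by apply/funext => w; rewrite add0r scale1r.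
(* [C D] is the covariance given [D]; [K i j] is the unconditional covariance of the residuals Z_i
   and Z_j. *)
pose C D F G := cond_exp P D (fun w => (F w - cond_exp P D F) * (G w - cond_exp P D G)).
pose K i j := \int[P]_w ((c i *m X w) 0 0 * (c j *m X w) 0 0) -
    \int[P]_w (c i *m X w) 0 0 * \int[P]_w (c j *m X w) 0 0.
(* Used with [B1] for the conditional covariance and with [setT] for the unconditional one. *)
have covX (D1 : set R) : measurable D1 -> (0 < P (Y @^-1` D1))%E -> forall i j,
    C (Y @^-1` D1) (fun w => X w i 0) (fun w => X w j 0) =
    K i j + b i * b j * cond_var P (Y @^-1` D1) Y.
  move=> mD D0 i j; rewrite !XE.
  exact: (cond_cov_lin Sigma_posdef xi_normal mD D0 (b i) (b j) (ac i) (ac j)).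
have PT : (0 < P (Y @^-1` setT))%E by rewrite preimage_setT probability_setT.
have covT i j : fine (covariance P (fun w => X w i 0) (fun w => X w j 0)) =
    K i j + b i * b j * cond_var P setT Y.
  by rewrite covariance_cond_exp; exact: (covX setT).
have varT : fine 'V_P[Y] = cond_var P setT Y.
  by rewrite /variance covariance_cond_exp.
have covYX i : fine (covariance P Y (fun w => X w i 0)) = b i * cond_var P setT Y.
  transitivity (C setT (fun w => ((0 + 1 *: a) *m X w) 0 0)
                       (fun w => ((c i + b i *: a) *m X w) 0 0)).
    by rewrite -YE -XE; exact: covariance_cond_exp.
  have a0 : a *m Sigma *m (0 : 'rV[R]_n)^T = 0 by rewrite trmx0 mulmx0.
  have := cond_cov_lin Sigma_posdef xi_normal measurableT PT 1 (b i) a0 (ac i).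
  rewrite preimage_setT /C => ->.
  rewrite [X in X - _](_ : _ = 0) ?[X in _ - X * _](_ : _ = 0) ?mul0r ?subrr ?add0r ?mul1r//.
  - under eq_Rintegral do rewrite mul0mx mxE.
    by rewrite Rintegral_cst// mul0r.
  - under eq_Rintegral do rewrite mul0mx mxE mul0r.
    by rewrite Rintegral_cst// mul0r.
have ti := tempered_integrable.
have ty := tempered_lin Sigma_posdef xi_normal a.
have var0 : cond_var P setT Y = 0 -> cond_var P B Y = 0.
  apply: cond_var_eq0 => //.
  - by rewrite -[X in measurable X]setTI; exact: (measurable_lin xi a).
  - exact: (ti _ _ _ _ _ _ _ ty).
  - exact: (ti _ _ _ _ _ _ _ (temperedM_lin a ty)).
apply/matrixP => i j; rewrite !mxE.
rewrite covT varT big_ord1 !mxE !covYX varT.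
transitivity (C B (fun w => X w i 0) (fun w => X w j 0)).
  rewrite /C; congr (cond_exp P B); apply/funext => w.
  by rewrite !mxE big_ord1 !mxE.
rewrite covX// -/B.
(* If the variance of Y were 0, [var0] would make the conditional one 0 too, and both sides would
   reduce to [K i j]. Otherwise the division in beta_i gives exactly [b i]. *)
have [V0|V0] := eqVneq (cond_var P setT Y) 0; first by rewrite var0// V0; ring.
by rewrite !mulfK//; ring.
Qed.
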